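(* Let $X$ be a set and let $\mathbf{d},\mathbf{e}:X\times X\to[0,\infty]$ be distances such that every $\mathbf{e}$-Cauchy net in $X$ converges to some point of $X$ in the topology $\mathbf{e}_\circ$, $\mathbf{e}\circ\Phi^{\overline{\mathbf{d}}}\precapprox\mathbf{d}$, $\underline{\mathbf{d}}\precapprox\mathbf{e}$ and $\overline{\mathbf{d}}^{\mathrm{op}}\precapprox\mathbf{e}$. Then for every net $(x_\lambda)$ in $X$: $(x_\lambda)$ is $\mathbf{d}$-pre-Cauchy if and only if there exists a subset $Y\subseteq X$ with $Y\equiv^{\mathbf{d}}(x_\lambda)$. Moreover, any such $Y$ is necessarily $\mathbf{d}$-directed.
   Context: Write $x\mathbf{d}y=\mathbf{d}(x,y)$. Conventions: $a_+=\max(a,0)$, $\infty-\infty=0$, $\inf\emptyset=\infty$, $\sup\emptyset=0$ in $[0,\infty]$. A relation is identified with the function equal to $0$ where it holds and $\infty$ elsewhere. For $\mathbf{f},\mathbf{g}:X\times X\to[0,\infty]$, $a(\mathbf{f}\circ\mathbf{g})b=\inf_{c\in X}(a\mathbf{f}c+c\mathbf{g}b)$. $\mathbf{d}$ is a distance if $x\mathbf{d}y\leq x\mathbf{d}z+z\mathbf{d}y$ for all $x,y,z$. $x\mathbf{d}^{\mathrm{op}}y=y\mathbf{d}x$. $x\overline{\mathbf{d}}z=\sup_{y\in X}(x\mathbf{d}y-z\mathbf{d}y)_+$ and $z\underline{\mathbf{d}}y=\sup_{x\in X}(x\mathbf{d}y-x\mathbf{d}z)_+$. $\mathbf{e}\circ\Phi^{\mathbf{f}}=\sup_{n\in\mathbb{N}}(\mathbf{e}\circ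 n\mathbf{f})=\sup_{\epsilon>0}(\mathbf{e}\circ\mathord{<^{\mathbf{f}}_\epsilon})$, where $a<^{\mathbf{f}}_\epsilon b$ iff $a\mathbf{f}b<\epsilon$. Uniform preorder: $\mathbf{f}\precapprox\mathbf{g}$ iff for every $Z\subseteq X\times X$, $\inf_{(a,b)\in Z}a\mathbf{g}b=0$ implies $\inf_{(a,b)\in Z}a\mathbf{f}b=0$ (equivalently, for all $\epsilon>0$ there is $\delta>0$ such that $a\mathbf{g}b<\delta$ implies $a\mathbf{f}b<\epsilon$ for all $a,b$). Nets $(x_\lambda)_{\lambda\in\Lambda}$ are indexed by non-empty sets $\Lambda$ with a transitive, possibly non-reflexive relation $\prec$ such that for all $\gamma,\delta$ there is $\lambda$ with $\gamma,\delta\prec\lambda$; limits and convergence use tails $\{\lambda:\lambda\succ\gamma\}$. $(x_\lambda)$ is $\mathbf{f}$-pre-Cauchy iff $\lim_\gamma\limsup_\delta x_\gamma\mathbf{f}x_\delta=0$, and $\mathbf{f}$-Cauchy iff $\lim_\gamma\sup_{\delta\succ\gamma}x_\gamma\mathbf{f}x_\delta=0$. $\mathbf{e}_\circ$ is the topology on $X$ with subbasis the sets $\{x:c\mathbf{e}x>r\}$, $c\in X$, $r\in(0,\infty)$. $Y$ is $\mathbf{d}$-directed if for every finite $F\subseteq Y$, $\inf_{y\in Y}\sup_{x\in F}x\mathbf{d}y=0$. $Y\equiv^{\mathbf{d}}(x_\lambda)$ means: $\lim_\lambda y\mathbf{d}x_\lambda=0$ for all $y\in Y$, and $\lim_\lambda\inf_{y\in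 Y}x_\lambda\mathbf{d}y=0$. *)

(* Defs.v *)
From HB Require Import structures.
From mathcomp Require Import all_boot all_order all_algebra.
From mathcomp Require Import all_classical all_reals all_analysis.

Set Implicit Arguments.
Unset Strict Implicit.
Unset Printing Implicit Defensive.

Import Order.TTheory GRing.Theory Num.Theory.
Import numFieldNormedType.Exports.

Local Open Scope classical_set_scope.
Local Open Scope ring_scope.
Local Open Scope ereal_scope.

(* Functions X * X -> [0, +oo] are represented by X -> X -> \bar R; the values
   of the two given distances are required to be nonnegative in is_distance,
   and every function derived from them below is then nonnegative as well. *)
Definition is_distance (R : realType) (X : Type) (d : X -> X -> \bar R) : Prop :=
  (forall x y, 0 <= d x y) /\ (forall x y z, d x y <= d x z + d z y).

Definition opdist (R : realType) (X : Type) (d : X -> X -> \bar R) :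
    X -> X -> \bar R :=
  fun x y => d y x.

Definition dcomp (R : realType) (X : Type) (f g : X -> X -> \bar R) :
    X -> X -> \bar R :=
  fun a b => ereal_inf (range (fun c => f a c + g c b)).

(* In \bar R one has +oo - +oo = -oo, so that the positive part of +oo - +oo
   is 0, in accordance with the convention +oo - +oo = 0. *)
Definition upperd (R : realType) (X : Type) (d : X -> X -> \bar R) :
    X -> X -> \bar R :=
  fun x z => ereal_sup (range (fun y => maxe (d x y - d z y) 0)).

Definition lowerd (R : realType) (X : Type) (d : X -> X -> \bar R) :
    X -> X -> \bar R :=
  fun z y => ereal_sup (range (fun x => maxe (d x y - d x z) 0)).

(* e o Phi^f = sup_n (e o (n f)) *)
Definition comp_Phi (R : realType) (X : Type) (e f : X -> X -> \bar R) :
    X -> X -> \bar R :=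
  fun a b => ereal_sup
    (range (fun n : nat => dcomp e (fun x y => n%:R%:E * f x y) a b)).

Definition precapprox (R : realType) (X : Type) (f g : X -> X -> \bar R) : Prop :=
  forall Z : set (X * X),
    ereal_inf [set g p.1 p.2 | p in Z] = 0 ->
    ereal_inf [set f p.1 p.2 | p in Z] = 0.

(* The relation need not be reflexive or antisymmetric. *)
Record netIndex := NetIndex {
  net_sort :> Type;
  net_lt : net_sort -> net_sort -> Prop;
  net_inhabited : inhabited net_sort;
  net_lt_trans : forall x y z, net_lt x y -> net_lt y z -> net_lt x z;
  net_directed : forall x y, exists z, net_lt x z /\ net_lt y z }.

Definition tail (L : netIndex) (l : L) : set L := [set m | net_lt l m].

Definition tails (L : netIndex) : set_system L := filter_from setT (@tail L).
Arguments tails : clear implicits.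

#[global] Instance tails_proper_filter (L : netIndex) : ProperFilter (tails L).
Proof.
apply: filter_from_proper => [|l _]; last first.
  by have [m [lm _]] := net_directed l l; exists m.
apply: filter_from_filter; first by have [l] := net_inhabited L; exists l.
move=> l m _ _; have [k [lk mk]] := net_directed l m.
by exists k => // j kj; split; [exact: net_lt_trans lk kj|exact: net_lt_trans mk kj].
Qed.

Definition net_limsup (R : realType) (L : netIndex) (u : L -> \bar R) : \bar R :=
  ereal_inf (range (fun k : L => ereal_sup [set u m | m in tail k])).

Definition pre_Cauchy (R : realType) (X : Type) (f : X -> X -> \bar R)
    (L : netIndex) (x : L -> X) : Prop :=
  net_limsup (fun m => f (x l) (x m)) @[l --> tails L] --> (0 : \bar R).

Definition is_Cauchy (R : realType) (X : Type) (f : X -> X -> \bar R)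
    (L : netIndex) (x : L -> X) : Prop :=
  ereal_sup [set f (x l) (x m) | m in tail l] @[l --> tails L] --> (0 : \bar R).

(* X endowed with the topology e_o *)
Definition hole_space (R : realType) (X : Type) (e : X -> X -> \bar R) : Type := X.

Definition hole_subbase (R : realType) (X : Type) (e : X -> X -> \bar R) :
    set (set (hole_space e)) :=
  [set U | exists (c : X) (r : R), (0 < r)%R /\ U = [set x | r%:E < e c x]].

HB.instance Definition _ (R : realType) (X : Type) (e : X -> X -> \bar R) :=
  gen_eqMixin (hole_space e).
HB.instance Definition _ (R : realType) (X : Type) (e : X -> X -> \bar R) :=
  gen_choiceMixin (hole_space e).
HB.instance Definition _ (R : realType) (X : Type) (e : X -> X -> \bar R) :=
  isSubBaseTopological.Build (hole_space e) (@hole_subbase R X e) id.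

Definition hole_complete (R : realType) (X : Type) (e : X -> X -> \bar R) : Prop :=
  forall (L : netIndex) (x : L -> X), is_Cauchy e x ->
    exists p : hole_space e, (x l : hole_space e) @[l --> tails L] --> p.

(* Adjoining 0 makes the supremum over the empty set equal to 0, as it has to be
   in [0, +oo]; in \bar R it would be -oo. *)
Definition is_directed (R : realType) (X : Type) (d : X -> X -> \bar R)
    (Y : set X) : Prop :=
  forall F : set X, finite_set F -> F `<=` Y ->
    ereal_inf [set ereal_sup (0 |` [set d x y | x in F]) | y in Y] = 0.

Definition equiv_net (R : realType) (X : Type) (d : X -> X -> \bar R)
    (Y : set X) (L : netIndex) (x : L -> X) : Prop :=
  (forall y, Y y -> d y (x l) @[l --> tails L] --> (0 : \bar R)) /\
  ereal_inf [set d (x l) y | y in Y] @[l --> tails L] --> (0 : \bar R).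

(* Main.v *)
Require Import Defs.
From HB Require Import structures.
From mathcomp Require Import all_boot all_order all_algebra.
From mathcomp Require Import all_classical all_reals all_analysis.
From mathcomp Require Import lra.

Set Implicit Arguments.
Unset Strict Implicit.
Unset Printing Implicit Defensive.

Import Order.TTheory GRing.Theory Num.Theory.

Local Open Scope classical_set_scope.
Local Open Scope ring_scope.
Local Open Scope ereal_scope.

(** If [Y] is equivalent to the net, then [d]-small steps from the net to [Y] and
    back to the net, or from a finite part of [Y] to the net and back to [Y],
    combine to give pre-Cauchyness and directedness.

    Conversely, for a [d]-pre-Cauchy net one takes for [Y] all points [y] with
    [d y x_l --> 0].  If [d c x_l] is eventually small, the hypothesis on
    [comp_Phi e (upperd d)] moves [c] by a small [e]-step to a point [c'] such
    that [d c' x_l] is eventually as small as we like.  Iterating with [e]-steps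
    of size [r / 2 ^ n] gives an [e]-Cauchy sequence starting from a late point
    [c] of the net; its limit [y] satisfies [e c y <= 2 r] because balls of [e]
    are closed for the hole topology.  The other two hypotheses carry
    [d c_n x_l] over to [d y x_l] and [d x_k c] over to [d x_k y].  Since [d]
    may be nonzero on the diagonal, [c] has to be taken later in the net than
    [x_k]. *)

(** * Infima and limits of nonnegative extended reals *)

Section ereal_nonneg.
Context {R : realType}.
Implicit Types (S : set (\bar R)) (a b : \bar R) (r : R).

Lemma ereal_inf_eq0P S : (forall s, S s -> 0 <= s) ->
  ereal_inf S = 0 <-> forall r, (0 < r)%R -> exists2 s, S s & s < r%:E.
Proof.
move=> S0; split=> [inf0 r r0|infS].
  have : ereal_inf S < r%:E by rewrite inf0 lte_fin.
  by move=> /ereal_inf_lt[s Ss sr]; exists s.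
apply/eqP; rewrite eq_le; apply/andP; split; last exact: le_ereal_inf_tmp.
apply/lee_addgt0Pr => r r0; rewrite add0e.
have [s Ss sr] := infS _ r0.
exact: (le_trans (ereal_inf_lbound Ss) (ltW sr)).
Qed.

(** The convention [+oo - +oo = -oo] does no harm: for [b = +oo] the right-hand side is [+oo]. *)
Lemma le_adde_of_sube_le a b r : 0 <= b -> a - b <= r%:E -> a <= b + r%:E.
Proof.
by case: a b => [a| |] [b| |]//= _; rewrite ?leey ?leNye// -EFinB -EFinD !lee_fin; lra.
Qed.

Lemma net_cvg0P (L : netIndex) (u : L -> \bar R) : (forall l, 0 <= u l) ->
  u l @[l --> tails L] --> (0 : \bar R) <->
  forall r, (0 < r)%R -> \forall l \near tails L, u l < r%:E.
Proof.
move=> u0; split=> [ucvg r r0|ucvg].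
  apply: (ucvg [set y | y < r%:E]).
  by apply: open_nbhs_nbhs; split; [exact: open_ereal_lt_ereal|rewrite /= lte_fin].
move=> A [r /= r0 rA]; apply: filterS (ucvg _ r0) => l /=.
have := u0 l; case: (u l) => [s| |]//=; rewrite lee_fin lte_fin => s0 sr.
by apply: rA; rewrite /= sub0r normrN ger0_norm.
Qed.

End ereal_nonneg.

Lemma ltr_div_exp2 {R : realType} (r s : R) (n : nat) : (0 < s)%R ->
  (Num.truncn (r / s) < n)%N -> (r / 2 ^+ n < s)%R.
Proof.
move=> s0 rsn; rewrite ltr_pdivrMr ?exprn_gt0// [(s * _)%R]mulrC -ltr_pdivrMr//.
apply: (lt_le_trans (truncnS_gt _)); rewrite -natrX ler_nat.
by apply: leq_trans rsn (ltnW _); rewrite ltn_expl.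
Qed.

(** Tails are nonempty, so no supremum takes the value [-oo] of the empty set. *)
Lemma net_limsup_ge0 {R : realType} (L : netIndex) (u : L -> \bar R) :
  (forall l, 0 <= u l) -> 0 <= net_limsup u.
Proof.
move=> u0; apply: le_ereal_inf_tmp => _ [k _ <-].
have [m [km _]] := net_directed k k.
by apply: le_trans (u0 m) _; apply: ereal_sup_ubound; exists m.
Qed.

(** [{classic X}] equips the bare type [X] with the choice structure that finite sets require. *)
Lemma finite_filter_forall {T X : Type} {F : set_system T} {FF : Filter F}
    (A : set X) (P : X -> T -> Prop) : finite_set A ->
    (forall z, A z -> \forall t \near F, P z t) ->
  \forall t \near F, forall z, A z -> P z t.
Proof.
move=> finA AP.
have [B AB] := (@finite_fsetP {classic X} A).1 finA.
have : F (\bigcap_(z in A) P z); last by apply: filterS => t Pt z /Pt.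
rewrite AB; apply: (@filter_bigI T {classic X}) => // z zB.
by apply: AP; rewrite AB.
Qed.

(** * The uniform preorder and the derived distances *)

Section uniform.
Context {R : realType} {X : Type}.
Implicit Types (d e f g : X -> X -> \bar R).

Lemma precapprox_modulus f g : (forall a b, 0 <= g a b) -> precapprox f g ->
  forall r : R, (0 < r)%R -> exists2 s : R, (0 < s)%R &
    forall a b, g a b < s%:E -> f a b < r%:E.
Proof.
move=> g0 fg r r0; apply: contrapT => noS.
(* If no [s] works for [r], then [g] has infimum 0 on this set, while [f] is at least [r] there. *)
pose Z : set (X * X) := [set p | r%:E <= f p.1 p.2].
have : r%:E <= ereal_inf [set f p.1 p.2 | p in Z].
  by apply: le_ereal_inf_tmp => _ [p Zp <-].
rewrite fg ?lee_fin ?leNgt ?r0//; apply/ereal_inf_eq0P.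
  by move=> _ [p _ <-].
move=> s s0; apply: contrapT => noZ; apply: noS; exists s => // a b gs.
rewrite ltNge; apply/negP => fr; apply: noZ.
by exists (g a b) => //; exists (a, b).
Qed.

Lemma upperd_lt d (r : R) a b z : is_distance d ->
  upperd d a b < r%:E -> d a z <= d b z + r%:E.
Proof.
move=> [d0 _] abr; apply: le_adde_of_sube_le => //.
apply: le_trans (ltW abr); apply: le_ereal_sup_tmp; exists (maxe (d a z - d b z) 0).
  by exists z.
by rewrite le_max lexx.
Qed.

Lemma lowerd_lt d (r : R) a b z : is_distance d ->
  lowerd d a b < r%:E -> d z b <= d z a + r%:E.
Proof.
move=> [d0 _] abr; apply: le_adde_of_sube_le => //.
apply: le_trans (ltW abr); apply: le_ereal_sup_tmp; exists (maxe (d z b - d z a) 0).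
  by exists z.
by rewrite le_max lexx.
Qed.

Lemma upperd_ge0 d a b : 0 <= upperd d a b.
Proof.
apply: le_ereal_sup_tmp; exists (maxe (d a a - d b a) 0); first by exists a.
by rewrite le_max lexx orbT.
Qed.

(** The bound on the [e]-step is independent of [s]: with [r <= n * s], a cost [n * f c b] below [r]
    forces [f c b < s]. *)
Lemma comp_Phi_lt e f a b (r s : R) :
    (forall x y, 0 <= e x y) -> (forall x y, 0 <= f x y) ->
    comp_Phi e f a b < r%:E -> (0 < s)%R ->
  exists2 c, e a c < r%:E & f c b < s%:E.
Proof.
move=> e0 f0 abr s0.
pose n := (Num.truncn (`|r| / s)).+1.
have rns : (r <= n%:R * s)%R.
  rewrite -ler_pdivrMr//; apply: le_trans (ltW (truncnS_gt _)).
  by rewrite ler_pM2r ?invr_gt0// ler_norm.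
have : Defs.dcomp e (fun x y => n%:R%:E * f x y) a b < r%:E.
  by apply: le_lt_trans abr; apply: ereal_sup_ubound; exists n.
move=> /ereal_inf_lt[_ [c _ <-] cr]; exists c.
  by apply: le_lt_trans cr; rewrite leeDl// mule_ge0.
rewrite ltNge; apply/negP => sf; move: cr; rewrite ltNge => /negP; apply.
apply: (@le_trans _ _ (n%:R%:E * f c b)); last by rewrite leeDr.
apply: (@le_trans _ _ (n%:R%:E * s%:E)); first by rewrite -EFinM lee_fin.
by rewrite lee_wpmul2l.
Qed.

End uniform.

(** * Equivalence with a net implies pre-Cauchyness and directedness *)

Section nets.
Context {R : realType} {X : Type} (d : X -> X -> \bar R) (hd : is_distance d).
Context (L : netIndex) (x : L -> X).

Let d0 a b : 0 <= d a b. Proof. by case: hd. Qed.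

Let dlt (r s : R) a c b : d a c < r%:E -> d c b < s%:E -> d a b < (r + s)%:E.
Proof. by case: hd => _ tri ac cb; apply: le_lt_trans (tri a b c) _; rewrite EFinD lteD. Qed.

Definition eventually_within (r : R) (c : X) : Prop :=
  \forall l \near tails L, d c (x l) < r%:E.

Lemma pre_CauchyP : pre_Cauchy d x <->
  forall r : R, (0 < r)%R -> \forall l \near tails L, eventually_within r (x l).
Proof.
rewrite /pre_Cauchy net_cvg0P; last by move=> l; exact: net_limsup_ge0.
split=> H r r0.
  apply: filterS (H _ r0) => l /ereal_inf_lt[_ [k _ <-] kr].
  exists k => // m km; apply: le_lt_trans kr; apply: ereal_sup_ubound.
  by exists m.
have r20 : (0 < r / 2)%R by lra.
apply: filterS (H _ r20) => l [k _ kr].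
apply: (@le_lt_trans _ _ (r / 2)%:E); last by rewrite lte_fin; lra.
apply: (@le_trans _ _ (ereal_sup [set d (x l) (x m) | m in tail k])).
  by apply: ereal_inf_lbound; exists k.
by apply: ge_ereal_sup => _ [m km <-]; apply: ltW; exact: kr.
Qed.

Lemma equiv_netP (Y : set X) : equiv_net d Y x <->
  (forall y, Y y -> forall r : R, (0 < r)%R -> eventually_within r y) /\
  (forall r : R, (0 < r)%R ->
     \forall l \near tails L, exists2 y, Y y & d (x l) y < r%:E).
Proof.
rewrite /equiv_net net_cvg0P; last first.
  by move=> l; apply: le_ereal_inf_tmp => _ [y _ <-].
split=> -[Yx xY]; split.
- by move=> y Yy; apply/net_cvg0P; [|exact: Yx].
- move=> r r0; apply: filterS (xY _ r0) => l /ereal_inf_lt[_ [y Yy <-] yr].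
  by exists y.
- by move=> y Yy; apply/net_cvg0P => // r; exact: Yx.
- move=> r r0; apply: filterS (xY _ r0) => l [y Yy].
  by apply: le_lt_trans; apply: ereal_inf_lbound; exists y.
Qed.

Lemma equiv_net_pre_Cauchy (Y : set X) : equiv_net d Y x -> pre_Cauchy d x.
Proof.
move=> /equiv_netP[Yx xY]; apply/pre_CauchyP => r r0.
have r20 : (0 < r / 2)%R by lra.
apply: filterS (xY _ r20) => l [y Yy ly].
by apply: filterS (Yx _ Yy _ r20) => m ym; rewrite (splitr r); exact: dlt ly ym.
Qed.

Lemma equiv_net_directed (Y : set X) : equiv_net d Y x -> is_directed d Y.
Proof.
move=> /equiv_netP[Yx xY] F finF FY; apply/ereal_inf_eq0P.
  by move=> _ [y _ <-]; apply: ereal_sup_ubound; left.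
(* The supremum over [F] weakens [<] to [<=], so the two steps should add up to [r / 2]. *)
move=> r r0; have r40 : (0 < r / 4)%R by lra.
have Fx : \forall l \near tails L, forall z, F z -> d z (x l) < (r / 4)%:E.
  by apply: finite_filter_forall => // z /FY Yz; exact: Yx.
have [l [lF [y Yy ly]]] := filter_ex (filterI Fx (xY _ r40)).
exists (ereal_sup (0 |` [set d z y | z in F])); first by exists y.
apply: (@le_lt_trans _ _ (r / 4 + r / 4)%:E); last by rewrite lte_fin; lra.
apply: ge_ereal_sup => _ [->|[z Fz <-]]; first by rewrite lee_fin; lra.
exact: ltW (dlt (lF _ Fz) ly).
Qed.

End nets.

(** * Limits of sequences with geometric [e]-steps *)

Definition nat_net : netIndex.
Proof.
apply: (@NetIndex nat (fun m n => (m < n)%N)).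
- exact: (inhabits 0%N).
- by move=> a b c; exact: ltn_trans.
- by move=> a b; exists (maxn a b).+1; rewrite !ltnS leq_maxl leq_maxr.
Defined.

Lemma open_hole_subbase {R : realType} {X : Type} (e : X -> X -> \bar R)
  (U : set (hole_space e)) : hole_subbase U -> open U.
Proof.
by move=> eU; exists [set U]; [move=> _ ->; exact: (finI_from1 id)|rewrite bigcup_set1].
Qed.

Section limit.
Context {R : realType} {X : Type} (e : X -> X -> \bar R).
Hypotheses (he : is_distance e) (hcomplete : hole_complete e).

(** Induction on the number of steps, as [r / 2 ^ n] plus [2 * (r / 2 ^ n.+1)] is [2 * (r / 2 ^ n)].
    At least one step is taken because [e] may be nonzero on the diagonal. *)
Lemma geometric_step_bound (r : R) (c : nat -> X) :
    (forall n, e (c n) (c n.+1) < (r / 2 ^+ n)%:E) ->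
  forall k n, e (c n) (c (n + k.+1)%N) <= (2 * (r / 2 ^+ n))%:E.
Proof.
case: he => e0 tri step.
have r0 n : (0 < r / 2 ^+ n)%R by rewrite -lte_fin; exact: le_lt_trans (step n).
elim=> [|k IH] n.
  rewrite addn1; apply: (le_trans (ltW (step n))).
  by rewrite lee_fin; have := r0 n; lra.
apply: (le_trans (tri _ _ (c n.+1))); rewrite addnS -addSn.
apply: (@le_trans _ _ ((r / 2 ^+ n)%:E + (2 * (r / 2 ^+ n.+1))%:E)).
  by rewrite leeD// ltW.
by rewrite -EFinD lee_fin exprS invfM; lra.
Qed.

Lemma geometric_limit (r : R) (c : nat -> X) :
    (forall n, e (c n) (c n.+1) < (r / 2 ^+ n)%:E) ->
  exists y, forall n, e (c n) y <= (2 * (r / 2 ^+ n))%:E.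
Proof.
move=> step; have bound := geometric_step_bound step.
have [e0 _] := he.
have r0 n : (0 < r / 2 ^+ n)%R by rewrite -lte_fin; exact: le_lt_trans (step n).
have tail_bound m n : (n < m)%N -> e (c n) (c m) <= (2 * (r / 2 ^+ n))%:E.
  by move=> nm; have := bound (m - n.+1)%N n; rewrite -addSnnS subnKC.
have cauchy : is_Cauchy e (c : nat_net -> X).
  apply/net_cvg0P => [l|s s0].
    apply: le_ereal_sup_tmp; exists (e (c l) (c l.+1)) => //.
    by exists l.+1 => //=; exact: ltnSn.
  exists (Num.truncn (2 * r / s)) => // n /= sn.
  apply: (@le_lt_trans _ _ (2 * (r / 2 ^+ n))%:E).
    by apply: ge_ereal_sup => _ [m nm <-]; exact: tail_bound.
  by rewrite lte_fin mulrA; exact: ltr_div_exp2.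
have [y cy] := hcomplete cauchy; exists y => n.
rewrite leNgt; apply/negP => far.
(* The complement of the closed ball is a subbasic open set. If it contained [y], it would contain
   all late [c m], against [tail_bound]. *)
have /cy[k _ kfar] : nbhs y [set z : hole_space e | (2 * (r / 2 ^+ n))%:E < e (c n) z].
  apply: open_nbhs_nbhs; split => //; apply: open_hole_subbase.
  by exists (c n), (2 * (r / 2 ^+ n))%R; split => //; have := r0 n; lra.
pose m := (maxn k n).+1.
have := kfar m; rewrite /tail /= /m ltnS leq_maxl => /(_ isT).
by apply/negP; rewrite -leNgt tail_bound// ltnS leq_maxr.
Qed.

End limit.

(** * Construction of [Y] from a pre-Cauchy net *)

Lemma dependent_choice_from {X : Type} (Q : nat -> X -> Prop)
    (S : nat -> X -> X -> Prop) (a : X) : Q 0%N a ->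
    (forall n c, Q n c -> exists2 c', Q n.+1 c' & S n c c') ->
  exists c : nat -> X, [/\ c 0%N = a, forall n, Q n (c n) &
    forall n, S n (c n) (c n.+1)].
Proof.
move=> Qa next.
have /choice[f fP] : forall p : nat * X, exists c',
    Q p.1 p.2 -> Q p.1.+1 c' /\ S p.1 p.2 c'.
  move=> [n c] /=; have [Qc|nQc] := pselect (Q n c).
    by have [c' ? ?] := next _ _ Qc; exists c'.
  by exists c => /nQc.
pose c := fix c n := if n is m.+1 then f (m, c m) else a.
have Qc n : Q n (c n) by elim: n => // n /(fP (n, c n))[].
by exists c; split => // n; have [] := fP (n, c n) (Qc n).
Qed.

Section pre_Cauchy_equiv.
Context {R : realType} {X : Type} (d e : X -> X -> \bar R).
Hypotheses (hd : is_distance d) (he : is_distance e).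
Hypothesis hcomplete : hole_complete e.
Hypothesis hPhi : precapprox (comp_Phi e (upperd d)) d.
Hypothesis hlower : precapprox (lowerd d) e.
Hypothesis hupper : precapprox (opdist (upperd d)) e.
Context (L : netIndex) (x : L -> X) (xC : pre_Cauchy d x).

Local Notation within := (eventually_within d x).

(** The threshold [s] depends on [r] only and the accuracy [t] is free, so each step can meet the
    threshold of the next one. *)
Lemma improve_within (r : R) : (0 < r)%R -> exists2 s : R, (0 < s)%R &
  forall c, within s c -> forall t : R, (0 < t)%R ->
    exists2 c', within t c' & e c c' < r%:E.
Proof.
move=> r0; have [d0 _] := hd; have [e0 _] := he.
have [s s0 sP] := precapprox_modulus d0 hPhi r0.
exists s => // c cs t t0; have t20 : (0 < t / 2)%R by lra.
(* This [x l] is both [d]-close to [c] and within [t / 2] of the later net; [c'] inherits the latter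
   through [upperd]. *)
have [l [/sP cl lt]] := filter_ex (filterI cs ((pre_CauchyP hd x).1 xC _ t20)).
have [c' cc' c'l] := comp_Phi_lt e0 (upperd_ge0 d) cl t20.
exists c' => //; apply: filterS lt => m lm.
apply: le_lt_trans (upperd_lt _ hd c'l) _.
by rewrite [in ltRHS](splitr t) EFinD lteD2rE.
Qed.

Lemma limit_near (r : R) : (0 < r)%R -> exists2 s : R, (0 < s)%R &
  forall c, within s c -> exists2 y,
    forall t : R, (0 < t)%R -> within t y & e c y < r%:E.
Proof.
move=> r0; have [d0 _] := hd; have [e0 _] := he.
(* The limit will satisfy [e c y <= 2 * q], which is below [r]. *)
pose q := (r / 4)%R.
have q0 n : (0 < q / 2 ^+ n)%R by rewrite divr_gt0 ?exprn_gt0// /q; lra.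
have /choice[s sP] : forall n, exists s : R, (0 < s)%R /\
    forall c, within s c -> forall t : R, (0 < t)%R ->
    exists2 c', within t c' & e c c' < (q / 2 ^+ n)%:E.
  by move=> n; have [s] := improve_within (q0 n); exists s.
(* The bound [s n] permits the next step; the bound [q / 2 ^ n] makes the accuracy tend to 0. *)
pose Q n c := within (Num.min (s n) (q / 2 ^+ n))%R c.
exists (Num.min (s 0%N) (q / 2 ^+ 0))%R.
  by rewrite lt_min q0 andbT; have [] := sP 0%N.
move=> a Qa.
have [|c [c0 Qc cS]] := @dependent_choice_from X Q
    (fun n c c' => e c c' < (q / 2 ^+ n)%:E) a Qa.
  move=> n c Qc; have [_] := sP n; apply.
    by apply: filterS Qc => l /lt_le_trans; apply; rewrite lee_fin ge_min lexx.
  by rewrite lt_min q0 andbT; have [] := sP n.+1.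
have [y yP] := geometric_limit he hcomplete cS.
exists y; last first.
  rewrite -c0; apply: le_lt_trans (yP 0%N) _.
  by rewrite lte_fin expr0 /q; lra.
move=> t t0; have t20 : (0 < t / 2)%R by lra.
have [u u0 uP] := precapprox_modulus e0 hupper t20.
(* The bound [u] gives [upperd d y (c n) < t / 2], and [t / 2] makes [c n] itself accurate
   enough. *)
pose v := Num.min u (t / 2)%R.
have v0 : (0 < v)%R by rewrite lt_min u0.
pose n := (Num.truncn (2 * q / v)).+1.
have qv : (2 * (q / 2 ^+ n) < v)%R.
  by rewrite mulrA; exact: ltr_div_exp2.
have cu : e (c n) y < u%:E.
  apply: le_lt_trans (yP n) _; rewrite lte_fin (lt_le_trans qv)//.
  by rewrite ge_min lexx.
have qt : (q / 2 ^+ n <= t / 2)%R.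
  have : (v <= t / 2)%R by rewrite ge_min lexx orbT.
  by have := q0 n; lra.
apply: filterS (Qc n) => l cl.
apply: le_lt_trans (upperd_lt _ hd (uP _ _ cu)) _.
rewrite [in ltRHS](splitr t) EFinD lteD2rE//.
by apply: lt_le_trans cl _; rewrite lee_fin ge_min qt orbT.
Qed.

Lemma pre_Cauchy_equiv_net :
  equiv_net d [set y | forall t : R, (0 < t)%R -> within t y] x.
Proof.
apply/(equiv_netP hd); split=> [y|r r0]; first exact.
have [e0 _] := he; have r20 : (0 < r / 2)%R by lra.
have [u u0 uP] := precapprox_modulus e0 hlower r20.
have [s s0 sP] := limit_near u0.
have near_x := (pre_CauchyP hd x).1 xC.
apply: filterS (near_x _ r20) => k kx.
have [l [kl /sP[y yx ly]]] := filter_ex (filterI kx (near_x _ s0)).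
(* The small [e]-step from [x l] to [y] gives [d (x k) y <= d (x k) (x l) + r / 2]. *)
exists y => //; apply: le_lt_trans (lowerd_lt _ hd (uP _ _ ly)) _.
by rewrite [in ltRHS](splitr r) EFinD lteD2rE.
Qed.

End pre_Cauchy_equiv.

Theorem theorem11p5 (R : realType) (X : Type) (d e : X -> X -> \bar R)
  (hd : is_distance d) (he : is_distance e)
  (hcomplete : hole_complete e)
  (hPhi : precapprox (comp_Phi e (upperd d)) d)
  (hlower : precapprox (lowerd d) e)
  (hupper : precapprox (opdist (upperd d)) e)
  (L : netIndex) (x : L -> X) :
  (pre_Cauchy d x <-> exists Y : set X, equiv_net d Y x) /\
  (forall Y : set X, equiv_net d Y x -> is_directed d Y).
Proof.
split; last by move=> Y; exact: equiv_net_directed.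
split=> [xC|[Y]]; last exact: equiv_net_pre_Cauchy.
by eexists; exact: (pre_Cauchy_equiv_net hd he hcomplete hPhi hlower hupper xC).
Qed.
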